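(* Suppose $X$ is a compact Hausdorff space. Then: (1) If the set of sequential limit points of $X$ is dense in $X$, then $X$ is a $\upsilon$-space. (2) If $X$ is first countable, then $X$ is a $\upsilon$-space if and only if $X$ has no isolated points. (3) If $\{K_i:i\in I\}$ is a collection of closed subsets of $X$ and if each $K_i$ is a $\upsilon$-space, then the closure of $\bigcup_{i\in I}K_i$ is a $\upsilon$-space. (4) $X$ has a unique maximal compact $\upsilon$-subspace. (5) If $Y$ is a compact Hausdorff $\upsilon$-space, then $X\times Y$ is a $\upsilon$-space.
   Context: $C_R(X)$ denotes the algebra of real-valued continuous functions on $X$. A map $T$ on $C_R(X)$ is additive if $T(f+g)=T(f)+T(g)$ for all $f,g$; it is zero-preserving if for every $f\in C_R(X)$ and every $x\in X$, $f(x)=0$ implies $T(f)(x)=0$; it is a multiplication if there is $a\in C_R(X)$ with $T(f)=af$ for all $f$. A compact Hausdorff space $X$ is a $\upsilon$-space if every additive zero-preserving map on $C_R(X)$ is a multiplication (the empty space is allowed and counts as a $\upsilon$-space). A compact $\upsilon$-subspace of $X$ is a compact subspace of $X$ that is a $\upsilon$-space; maximality is with respect to inclusion. A point $x\in X$ is a sequential limit point of $X$ if there is a sequence $\{x_n\}$ in $X\setminus\{x\}$ with $x_n\to x$. *)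

(* Defs.v *)
(* Built on MathComp-Analysis; the real line is an arbitrary [R : realType]. *)
From HB Require Import structures.
From mathcomp Require Import all_boot all_order all_algebra.
From mathcomp Require Import all_classical all_reals all_analysis.

Set Implicit Arguments.
Unset Strict Implicit.
Unset Printing Implicit Defensive.

Import Order.TTheory GRing.Theory Num.Theory.
Import numFieldNormedType.Exports.

Local Open Scope classical_set_scope.
Local Open Scope ring_scope.

(* The pointwise ring structure on C_R(X) = [continuousType X R]. It is a
   [comPzRingType] only, because X may be empty and then 0 = 1. *)
Section continuous_functions_ring.
Context {X : topologicalType} {R : realType}.
Local Notation C := (continuousType X R).
Implicit Types f g h : C.

Let cont0 : continuous (fun _ : X => 0 : R).
Proof. by move=> x; exact: cvg_cst. Qed.

Let cont1 : continuous (fun _ : X => 1 : R).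
Proof. by move=> x; exact: cvg_cst. Qed.

Let contN f : continuous (fun x => - f x).
Proof. by move=> x; apply: cvgN; exact: cts_fun. Qed.

Let contD f g : continuous (fun x => f x + g x).
Proof. by move=> x; apply: cvgD; exact: cts_fun. Qed.

Let contM f g : continuous (fun x => f x * g x).
Proof. by move=> x; apply: cvgM; exact: cts_fun. Qed.

Definition cts_zero : C := mkcts cont0.
Definition cts_one : C := mkcts cont1.
Definition cts_opp f : C := mkcts (@contN f).
Definition cts_add f g : C := mkcts (@contD f g).
Definition cts_mul f g : C := mkcts (@contM f g).

Let addA : associative cts_add.
Proof. by move=> f g h; apply/continuousEP => x; exact: addrA. Qed.

Let addC : commutative cts_add.
Proof. by move=> f g; apply/continuousEP => x; exact: addrC. Qed.

Let add0 : left_id cts_zero cts_add.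
Proof. by move=> f; apply/continuousEP => x; exact: add0r. Qed.

Let addN : left_inverse cts_zero cts_opp cts_add.
Proof. by move=> f; apply/continuousEP => x; exact: addNr. Qed.

HB.instance Definition _ := GRing.isZmodule.Build C addA addC add0 addN.

Let mulA : associative cts_mul.
Proof. by move=> f g h; apply/continuousEP => x; exact: mulrA. Qed.

Let mulC : commutative cts_mul.
Proof. by move=> f g; apply/continuousEP => x; exact: mulrC. Qed.

Let mul1 : left_id cts_one cts_mul.
Proof. by move=> f; apply/continuousEP => x; exact: mul1r. Qed.

Let mulD : left_distributive cts_mul cts_add.
Proof. by move=> f g h; apply/continuousEP => x; exact: mulrDl. Qed.

HB.instance Definition _ :=
  GRing.Zmodule_isComPzRing.Build C mulA mulC mul1 mulD.

Lemma cts_addE f g x : (f + g) x = f x + g x. Proof. by []. Qed.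

Lemma cts_mulE f g x : (f * g) x = f x * g x. Proof. by []. Qed.

End continuous_functions_ring.

Section upsilon_spaces.
Variable R : realType.

Definition zero_preserving (X : topologicalType)
    (T : continuousType X R -> continuousType X R) : Prop :=
  forall (f : continuousType X R) (x : X), f x = 0 -> T f x = 0.

Definition multiplication (X : topologicalType)
    (T : continuousType X R -> continuousType X R) : Prop :=
  exists a : continuousType X R, forall f, T f = a * f.

Definition upsilon_space (X : topologicalType) : Prop :=
  [/\ compact [set: X],
      hausdorff_space X
    & forall T : continuousType X R -> continuousType X R,
        {morph T : f g / f + g} -> zero_preserving T -> multiplication T].

(* [set_type K] is the type of points of K with the topology induced by X. *)
Definition compact_upsilon_subspace (X : topologicalType) (K : set X) : Prop :=
  compact K /\ upsilon_space (set_type K).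

Definition maximal_compact_upsilon_subspace (X : topologicalType)
    (M : set X) : Prop :=
  compact_upsilon_subspace M /\
  forall K : set X, compact_upsilon_subspace K -> M `<=` K -> K = M.

End upsilon_spaces.

Definition sequential_limit_points (X : topologicalType) : set X :=
  [set x | exists2 u : nat -> X, (forall n, u n <> x) & u @ \oo --> x].

Definition first_countable (X : topologicalType) : Prop :=
  forall x : X, exists2 B : set (set X), countable B & nbhs x = filter_from B id.

Arguments sequential_limit_points X : clear implicits.
Arguments first_countable X : clear implicits.

(* Main.v *)
Require Import Defs.
From mathcomp Require Import all_boot all_order all_algebra.
From mathcomp Require Import all_classical all_reals all_analysis.
Import numFieldNormedType.Exports.
Import Order.TTheory GRing.Theory Num.Theory.
Local Open Scope classical_set_scope.

(** Let T be additive and zero-preserving. If f x = g x then T (f - g) x = 0,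
so T f x depends only on f x. Thus T acts at each point x through an additive
function phi_x : R -> R, and it is a multiplication exactly when every phi_x is
linear ([linear_at]); the multiplier is then T 1. For fixed f, the equation
T f x = T 1 x * f x is closed in x, so linearity on a dense set is enough
([dense_linear_at_multiplication]).

Linearity is obtained at two kinds of points.

- At a sequential limit point x = lim u_n. Put S = T f - T 1 * f. Being
  additive, phi_y is linear on rationals, so for r rational and k natural the
  map g |-> T g - T 1 * g sends k * (f + r) to k * S: a suitable r makes the
  argument small, while k magnifies S. Choosing r_n so that
  (n + 1) * (f (u_n) + r_n) tends to 0, these numbers are values along u of a
  continuous h with h x = 0, and |T h - T 1 * h| is at least |S| along u but
  vanishes at x. Hence S x = 0 ([linear_at_sequential_limit_point]).
- At the points of an injective continuous image of an upsilon-space K. Since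
  T f x depends only on f x, T descends to C_R(K) through Tietze
  extensions, and there it is a multiplication ([linear_at_image]).

Density of the first kind of points is (1). The second kind gives
[upsilon_space_dense_images], which yields (3) with the inclusions of the K_i,
and (5) with the slices {x} * Y. For (4), the closure of the union of all
compact upsilon-subspaces is by (3) the largest of them. In (2), first
countability turns non-isolated points into sequential limit points;
conversely, at an isolated point one may apply to f x an additive but nonlinear
function of R and extend by zero, which is continuous
([upsilon_space_no_isolated]). Such a function is the projection onto the
rationals along a Q-hyperplane avoiding 1, provided by Zorn's lemma. *)

(** * Subspaces and extension of continuous functions *)

Section topology.
Local Open Scope ring_scope.

Lemma cluster_continuous {S T : topologicalType} (f : S -> T) (p q : S) :
  continuous f -> cluster (nbhs p) q -> cluster (nbhs (f p)) (f q).
Proof.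
move=> cf pq A B /(cf p) pA /(cf q) qB.
by have [s [As Bs]] := pq _ _ pA qB; exists (f s).
Qed.

Lemma injective_hausdorff {S T : topologicalType} {f : S -> T} :
  continuous f -> injective f -> hausdorff_space T -> hausdorff_space S.
Proof. by move=> cf injf hT p q /(cluster_continuous _ _ _ cf)/hT/injf. Qed.

Lemma hausdorff_setX {S T : topologicalType} :
  hausdorff_space S -> hausdorff_space T -> hausdorff_space (S * T)%type.
Proof.
move=> hS hT [p1 p2] [q1 q2] pq; congr pair.
  by apply: hS; apply: (cluster_continuous fst) pq => z; exact: cvg_fst.
by apply: hT; apply: (cluster_continuous snd) pq => z; exact: cvg_snd.
Qed.

Lemma set_val_continuous {T : topologicalType} (A : set T) :
  continuous (set_val : A -> T).
Proof. exact: initial_continuous. Qed.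

Lemma set_val_inj {T : Type} (A : set T) : injective (set_val : A -> T).
Proof. exact: val_inj. Qed.

Lemma set_type_hausdorff {T : topologicalType} (A : set T) :
  hausdorff_space T -> hausdorff_space A.
Proof. exact/injective_hausdorff/set_val_inj/set_val_continuous. Qed.

Lemma set_type_compact {T : topologicalType} (A : set T) :
  compact A -> compact [set: A].
Proof.
move=> cA F FF _.
have FA : (set_val @ F) A.
  apply: (@filterS _ F _ setT); last exact: filterT.
  by move=> x _; exact: set_mem (valP x).
have [p [Ap clp]] := cA _ _ FA.
exists (SigSub (mem_set Ap)); split => // B C FB [_ [/= [W oW <-] Wp WC]].
have FB' : (set_val @ F) (set_val @` B).
  by apply: (@filterS _ F _ B) => // s Bs; exists s.
have [_ [[s Bs <-] Ws]] := clp _ W FB' (open_nbhs_nbhs (conj oW Wp)).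
by exists s; split => //; exact: WC.
Qed.

Lemma continuous_to_set_type {S T : topologicalType} (A : set T) (f : S -> A) :
  continuous (set_val \o f) -> continuous f.
Proof.
move=> cf x B [_ [/= [W oW <-] Wx WB]]; rewrite nbhs_simpl /=.
have := cf x W (open_nbhs_nbhs (conj oW Wx)); rewrite nbhs_simpl /=.
by apply: filterS => y; exact: WB.
Qed.

Lemma tietze_compact {R : realType} {X : topologicalType} {A : set X}
    {f : X -> R} :
  compact [set: X] -> hausdorff_space X -> closed A ->
  {within A, continuous f} ->
  exists g : continuousType X R, {in A, f =1 g}.
Proof.
move=> cX hX clA cf.
have cA : compact A by exact: subclosed_compact cX _.
have [M [_ /(_ (`|M| + 1))]] := compact_bounded (continuous_compact cf cA).
rewrite (le_lt_trans (ler_norm M)) ?ltrDl// => /(_ isT) fM.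
have M0 : 0 < `|M| + 1 by rewrite ltr_wpDl.
have [|g [fg cg _]] :=
  continuous_bounded_extension (compact_normal hX cX) clA M0 cf.
  by move=> x Ax; apply: fM; exists x.
by exists (mkcts cg).
Qed.

(** An injective continuous map from a compact space to a Hausdorff one is
closed, so f read on the image of j is continuous and Tietze applies. *)
Lemma extend_along_injection {R : realType} {K X : topologicalType} (j : K -> X)
    (f : continuousType K R) :
  compact [set: K] -> compact [set: X] -> hausdorff_space X ->
  continuous j -> injective j ->
  exists g : continuousType X R, forall k, g (j k) = f k.
Proof.
move=> cK cX hX cj injj.
have closed_j (C : set K) : closed C -> closed (j @` C).
  move=> clC; apply: compact_closed => //; apply: continuous_compact.
    exact: continuous_subspaceT.
  exact: subclosed_compact cK _.
pose h (x : X) : R :=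
  if pselect (exists k, j k = x) is left E then f (sval (cid E)) else 0.
have hj k : h (j k) = f k.
  rewrite /h; case: pselect => [E|[]]; last by exists k.
  by congr (f _); apply: injj; case: cid.
have clj : closed (range j) by apply: closed_j; exact: closedT.
have ch : {within range j, continuous h}.
  apply/continuous_closedP => C clC; apply/closed_subspaceP.
  exists (j @` (f @^-1` C)).
    by apply: closed_j; move/continuous_closedP: (@cts_fun _ _ f); exact.
  apply/seteqP; split => x [].
    by move=> [k Ck <-] jk; split => //; rewrite -[_ _]/(C (h (j k))) hj.
  move=> /[swap] -[k _ <-]; rewrite -[_ _]/(C (h (j k))) hj => Ck.
  by split; exists k.
have [g hg] := tietze_compact cX hX clj ch.
by exists g => k; rewrite -hj hg// inE; exists k.
Qed.

(** The sequence may repeat values, so the n-th point can only be required to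
receive some value c m with u m = u n. Each value is taken finitely often,
because u tends to a point outside its range; thus the range together with x is
closed, all its points but x are isolated in it, and the prescribed values
define a continuous function there, to which Tietze applies. *)
Lemma interpolate_along_sequence {R : realType} {X : topologicalType}
    {x : X} {u : nat -> X} {c : nat -> R} :
  compact [set: X] -> hausdorff_space X ->
  (forall n, u n <> x) -> u @ \oo --> x -> c @ \oo --> 0 ->
  exists2 g : continuousType X R, g x = 0 &
    forall n, exists2 m, u m = u n & g (u n) = c m.
Proof.
move=> cX hX ux cu cc.
have finite_closed (A : set X) : finite_set A -> closed A.
  by apply/accessible_finite_set_closed: A; exact: hausdorff_accessible.
pose A := x |` range u.
have avoid y N : exists2 V, nbhs y V &
    forall z, V z -> forall n, (n < N)%N -> u n = z -> z = y.
  exists (~` ((u @` `I_N) `\ y)).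
    apply: open_nbhs_nbhs; split; last by move=> [_ /(_ erefl)].
    rewrite openC; apply: finite_closed; apply: finite_setD.
    exact/finite_image/finite_II.
  move=> z nz n nN unz; have [//|zy] := pselect (z = y).
  by exfalso; apply: nz; split => //; exists n.
have isolA y : y <> x -> exists2 V, nbhs y V & forall z, V z -> A z -> z = y.
  move=> yx.
  move: hX; rewrite open_hausdorff => /(_ y x); case; first exact/eqP.
  move=> [/= V W] [/set_mem yV /set_mem xW] [oV oW /eqP VW0].
  have [N _ uW] := cu W (open_nbhs_nbhs (conj oW xW)).
  have [V' yV' V'P] := avoid y N.
  exists (V `&` V'); first by apply: filterI => //; exact: open_nbhs_nbhs.
  have VW z : V z -> ~ W z by move=> Vz Wz; rewrite -[False]/(set0 z) -VW0.
  move=> z [Vz V'z] [zx|[n _ unz]]; first by case: (VW z Vz); rewrite zx.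
  apply: (V'P z V'z n) => //; rewrite ltnNge; apply/negP => /uW /=.
  by rewrite unz; exact: VW.
have clA : closed A.
  move=> y clAy; have [->|yx] := pselect (y = x); first by left.
  have [V yV VA] := isolA y yx.
  by have [z [Az Vz]] := clAy _ yV; rewrite -(VA z).
pose h (z : X) : R :=
  if pselect (exists n, u n = z) is left E then c (sval (cid E)) else 0.
have hu n : exists2 m, u m = u n & h (u n) = c m.
  rewrite /h; case: pselect => [E|[]]; last by exists n.
  by case: cid => m um; exists m.
have hx : h x = 0.
  by rewrite /h; case: pselect => // E; exfalso; case: E => n /ux.
have ch : {within A, continuous h}.
  apply/subspace_continuousP => y Ay; change (h @ within A (nbhs y) --> h y).
  have [->|yx] := pselect (y = x).
    rewrite hx; apply/cvgrPdist_lt => e e0.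
    move/cvgrPdist_lt: cc => /(_ e e0) [N _ cN].
    have [V xV VP] := avoid x N.
    near=> z.
    have [->|[n _ unz]] : A z by near: z; exact: withinT.
      by rewrite hx subrr normr0.
    have [m um hm] := hu n; rewrite -unz hm; apply: cN => /=.
    rewrite leqNgt; apply/negP => mN; apply: (ux m).
    apply: (VP _ _ _ mN erefl).
    rewrite um unz; near: z; exact: cvg_within.
  have [V yV VA] := isolA y yx.
  apply: cvg_near_cst; rewrite near_withinE; apply: filterS yV => z Vz Az.
  by rewrite (VA z).
have [g hg] := tietze_compact cX hX clA ch.
exists g; first by rewrite -hg// inE; left.
move=> n; have [m um hm] := hu n; exists m; rewrite // -hg// inE.
by right; exists n.
Unshelve. all: by end_near. Qed.

(** Choose u n different from x in the intersection of the first n + 1 sets of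
a countable base at x. *)
Lemma first_countable_sequential_limit_point {X : topologicalType} (x : X) :
  first_countable X -> ~ isolated [set: X] x -> sequential_limit_points X x.
Proof.
move=> /(_ x)[B cB nbhsB] nx.
have BB V : B V -> nbhs x V by rewrite nbhsB => BV; exists V.
move: cB => /pfcard_geP[B0|[f]].
  have : nbhs x setT by exact: filterT.
  by rewrite nbhsB B0 => -[].
have fB i : nbhs x (f i) by apply: BB; exact: funS.
have near_f n : nbhs x [set y | forall i, (i < n)%N -> f i y].
  elim: n => [|n IHn]; first by apply: filterS filterT => y _ i.
  apply: filterS (filterI IHn (fB n)) => y [IHy fy] i.
  by rewrite ltnS leq_eqVlt => /predU1P[->//|/IHy].
have pick n : exists y, y <> x /\ forall i, (i < n.+1)%N -> f i y.
  apply: contrapT => /forallNP no; apply: nx; split; first by rewrite inE.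
  eexists; first exact: near_f n.+1.
  rewrite setIT; apply/seteqP; split => [y fy|y ->]; last first.
    exact: nbhs_singleton (near_f n.+1).
  by apply: contrapT => yx; apply: (no y).
have [u hu] := choice pick.
exists u => [n|V]; first by have [] := hu n.
rewrite nbhsB => -[W /(@surj _ _ _ _ f)[i _ <-] WV].
by exists i => // n /= lin; apply: WV; have [_] := hu n; exact.
Qed.

End topology.

(** * A nonlinear additive function on the reals *)

Section hamel.
Local Open Scope ring_scope.
Variable R : realType.

Definition rational_subspace (H : set R) : Prop :=
  forall (x y : R) (q : rat), H x -> H y -> H (x + ratr q * y).

(** A maximal Q-subspace H avoiding 1 works: for y outside H, the span of H and
y contains 1 = h + q y with q nonzero, so y is congruent to q^-1 modulo H. *)
Lemma rational_hyperplane : exists H : set R,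
  [/\ rational_subspace H, ~ H 1 & forall y, exists q : rat, H (y - ratr q)].
Proof.
pose P (H : set R) := rational_subspace H /\ ~ H 1.
have [F FP Ftot|H [[Hsub H1] Hmax]] := @Zorn_bigcup R P.
  split; last by move=> [A FA A1]; have [_] := FP A FA; exact.
  move=> x y q [A FA Ax] [B FB By].
  have [AB|BA] := Ftot _ _ FA FB.
    by exists B => //; apply: (FP B FB).1 => //; exact: AB.
  by exists A => //; apply: (FP A FA).1 => //; exact: BA.
exists H; split => // y.
(* The empty set satisfies the conditions of P, so 0 in H uses maximality. *)
have H0 : H 0.
  apply: contrapT => nH0; apply: (Hmax [set 0]).
    split => [x Hx|]; last by move/(_ 0 erefl).
    by case: nH0; have := Hsub x x (-1) Hx Hx; rewrite rmorphN1 mulN1r subrr.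
  split; last by move/eqP; rewrite oner_eq0.
  by move=> _ _ q -> ->; rewrite mulr0 addr0.
have Hscale q h : H h -> H (ratr q * h).
  by move=> Hh; have := Hsub 0 h q H0 Hh; rewrite add0r.
have [Hy|nHy] := pselect (H y); first by exists 0; rewrite rmorph0 subr0.
pose B := [set h + ratr q * y | h in H & q in [set: rat]].
have BE h q : H h -> B (h + ratr q * y) by move=> Hh; exists h => //; exists q.
have HB : H `<` B.
  split => [h Hh|]; first by have := BE h 0 Hh; rewrite rmorph0 mul0r addr0.
  move=> /(_ y) Hy; apply/nHy/Hy.
  by have := BE 0 1 H0; rewrite add0r rmorph1 mul1r.
have subB : rational_subspace B.
  move=> _ _ q [h1 Hh1 [q1 _ <-]] [h2 Hh2 [q2 _ <-]].
  have := BE _ (q1 + q * q2) (Hsub h1 h2 q Hh1 Hh2).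
  rewrite rmorphD rmorphM /= !mulrDl mulrDr mulrA !addrA.
  by rewrite [_ + _ * h2 + _]addrAC.
have [h Hh [q _ hq1]] : B 1.
  by apply: contrapT => nB1; exact: (Hmax B).
have q0 : ratr q != 0 :> R.
  by apply: contra_notN H1 => /eqP q0; move: hq1; rewrite q0 mul0r addr0 => <-.
exists q^-1; have := Hscale (- q^-1) h Hh.
rewrite rmorphN /= fmorphV -(addrK (ratr q * y) h) hq1.
by rewrite mulNr mulrBr mulr1 mulrA mulVf// mul1r opprB.
Qed.

(** The value at y is the unique rational congruent to y modulo the hyperplane.
Fixing 1 and taking only rational values, phi cannot be linear, as some real
number is irrational. *)
Lemma rational_valued_additive_function : exists phi : R -> R,
  [/\ {morph phi : x y / x + y}, phi 1 = 1 & forall x, rational (phi x)].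
Proof.
have [H [Hsub H1 Hq]] := rational_hyperplane.
have [q qP] := choice Hq.
have H0 : H 0.
  by have := Hsub _ _ (-1) (qP 0) (qP 0); rewrite rmorphN1 mulN1r subrr.
have Huniq y a b : H (y - ratr a) -> H (y - ratr b) -> a = b.
  move=> Ha Hb; apply/eqP; rewrite -subr_eq0; apply: contra_notT H1 => ab.
  have := Hsub _ _ (-1) Hb Ha.
  rewrite rmorphN1 mulN1r opprB addrC subrKA -rmorphB /=.
  move=> /(Hsub 0 _ (a - b)^-1 H0); rewrite add0r fmorphV mulVf//.
  by rewrite fmorph_eq0.
exists (fun x => ratr (q x)); split => [x y||x]; last by exists (q x).
  rewrite -rmorphD /=; congr ratr; apply: Huniq (qP _) _.
  have := Hsub _ _ 1 (qP x) (qP y).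
  by rewrite rmorph1 mul1r rmorphD /= opprD addrACA.
rewrite -[RHS](rmorph1 (@ratr R)); congr ratr.
by apply: Huniq (qP _) _; rewrite rmorph1 subrr.
Qed.

End hamel.

(** * Additive zero-preserving maps *)

Section additive.
Local Open Scope ring_scope.
Variable R : realType.

Definition cts_cst {X : topologicalType} (c : R) : continuousType X R :=
  mkcts (fun x : X => @cvg_cst R c X (nbhs x) _).

Definition linear_at {X : topologicalType}
    (T : continuousType X R -> continuousType X R) (x : X) : Prop :=
  forall f, T f x = T 1 x * f x.

Lemma zero_preserving_local {X : topologicalType}
    {T : continuousType X R -> continuousType X R}
    {f g : continuousType X R} {x : X} :
  {morph T : f g / f + g} -> zero_preserving T -> f x = g x -> T f x = T g x.
Proof.
move=> addT zT fg; rewrite -[f](subrK g) addT cts_addE zT ?add0r//.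
by rewrite cts_addE fg; exact: subrr.
Qed.

(** For each f the set where T f = T 1 * f is closed. *)
Lemma dense_linear_at_multiplication {X : topologicalType}
    {T : continuousType X R -> continuousType X R} (D : set X) :
  {morph T : f g / f + g} -> zero_preserving T ->
  dense D -> (forall x, D x -> linear_at T x) -> multiplication T.
Proof.
move=> addT zT denseD linD; exists (T 1) => f; apply/continuousEP => x.
pose E := T f - T 1 * f.
have oE : open (E @^-1` [set~ 0]).
  apply: open_comp; first by move=> y _; exact: (@cts_fun _ _ E).
  by rewrite openC; exact: closed_eq.
apply: contrapT => Ex.
have [|y [Ey /linD lin]] := denseD (E @^-1` [set~ 0]) _ oE.
  by exists x => /eqP; rewrite /= subr_eq0 => /eqP.
by apply: Ey; rewrite /E /= cts_addE; apply/eqP; rewrite subr_eq0 lin.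
Qed.

(** A function on K is extended along j, mapped by T and pulled back; by
locality of T the result does not depend on the extension, so this is an
additive zero-preserving map on C_R(K). *)
Lemma linear_at_image {K X : topologicalType} (j : K -> X)
    (T : continuousType X R -> continuousType X R) (k : K) :
  compact [set: X] -> hausdorff_space X -> upsilon_space R K ->
  continuous j -> injective j ->
  {morph T : f g / f + g} -> zero_preserving T -> linear_at T (j k).
Proof.
move=> cX hX [cK _ upK] cj injj addT zT f.
pose comp (g : continuousType X R) : continuousType K R :=
  mkcts (fun k => continuous_comp (cj k) (@cts_fun _ _ g (j k))).
have [ext extE] := choice (fun h : continuousType K R =>
  extend_along_injection j h cK cX hX cj injj).
pose S h := comp (T (ext h)).
have SE (h : continuousType K R) (g : continuousType X R) l :
    h l = g (j l) -> S h l = T g (j l).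
  move=> hg; rewrite -[S h l]/(T (ext h) (j l)).
  by apply: zero_preserving_local => //; rewrite extE.
have addS : {morph S : f g / f + g}.
  move=> g h; apply/continuousEP => l.
  rewrite (SE _ (ext g + ext h)) ?addT//.
  by rewrite !cts_addE !extE.
have [|a Sa] := upK S addS.
  by move=> h l h0; rewrite /S; apply: zT; rewrite extE.
rewrite -(SE (comp f) f) // -(SE 1 1) // !Sa mulr1.
by rewrite cts_mulE.
Qed.

Lemma upsilon_space_dense_images {X : topologicalType} {I : Type}
    (K : I -> topologicalType) (j : forall i, K i -> X) :
  compact [set: X] -> hausdorff_space X ->
  (forall i, upsilon_space R (K i)) ->
  (forall i, continuous (j i)) -> (forall i, injective (j i)) ->
  dense (\bigcup_i range (j i)) -> upsilon_space R X.
Proof.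
move=> cX hX upK cj injj dj; split=> // T addT zT.
apply: dense_linear_at_multiplication dj _ => // _ [i _ [k _ <-]].
exact: linear_at_image.
Qed.

(** * Linearity at sequential limit points *)

Lemma cts_mulrnE {X : topologicalType} (f : continuousType X R) n x :
  (f *+ n) x = f x *+ n.
Proof. by elim: n => // n IHn; rewrite !mulrS cts_addE IHn. Qed.

Lemma cts_mulrzE {X : topologicalType} (f : continuousType X R) (a : int) x :
  (f *~ a) x = f x *~ a.
Proof.
by case: a => n; [|rewrite !NegzE !mulrNz; congr (- _)]; exact: cts_mulrnE.
Qed.

Lemma additive_mulrn (U V : zmodType) (T : U -> V) f n :
  {morph T : f g / f + g} -> T (f *+ n) = T f *+ n.
Proof.
move=> addT; elim: n => [|n IHn]; last by rewrite !mulrS addT IHn.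
by apply: (addrI (T 0)); rewrite -addT !addr0.
Qed.

Lemma additive_mulrz (U V : zmodType) (T : U -> V) f (a : int) :
  {morph T : f g / f + g} -> T (f *~ a) = T f *~ a.
Proof.
move=> addT; case: a => n; first exact: additive_mulrn.
rewrite !NegzE !mulrNz -!pmulrn -(additive_mulrn _ _ _ f _ addT).
apply/eqP; rewrite -addr_eq0 -addT addNr.
by rewrite (additive_mulrn _ _ T 0 0).
Qed.

Lemma zero_preserving_rational {X : topologicalType}
    {T : continuousType X R -> continuousType X R} {r : R} (x : X) :
  {morph T : f g / f + g} -> zero_preserving T -> rational r ->
  T (cts_cst r) x = T 1 x * r.
Proof.
move=> addT zT /rationalP[a [b ->]].
have [->|b0] := eqVneq b 0%N; first by rewrite invr0 !mulr0 zT.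
have bR : b%:R != 0 :> R by rewrite pnatr_eq0.
apply: (mulIf bR); rewrite mulrA mulfVK// mulr_natr mulrzr.
rewrite -cts_mulrnE -cts_mulrzE -additive_mulrn// -additive_mulrz//.
apply: zero_preserving_local => //; rewrite cts_mulrnE cts_mulrzE.
by rewrite -[LHS]mulr_natr; exact: mulfVK.
Qed.

(** Nonlinearity at x would be seen along u: integer multiples of f, shifted by
rational constants to be small, give a function vanishing at x on which the
deviation of T from the multiplication by T 1 does not tend to 0. *)
Lemma linear_at_sequential_limit_point {X : topologicalType}
    (T : continuousType X R -> continuousType X R) (x : X) :
  compact [set: X] -> hausdorff_space X -> sequential_limit_points X x ->
  {morph T : f g / f + g} -> zero_preserving T -> linear_at T x.
Proof.
move=> cX hX [u ux cu] addT zT f.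
(* A rational within (n + 1)^-2 of - f (u n) survives the factor n + 1. *)
have approx n : exists r : R,
    rational r /\ `|(f (u n) + r) *+ n.+1| <= n.+1%:R^-1.
  have e0 : 0 < (n.+1%:R ^- 2 : R) by rewrite invr_gt0 exprn_gt0.
  have [|q] := @rat_in_itvoo R (f (u n) - n.+1%:R ^- 2) (f (u n)).
    by rewrite ltrBlDr ltrDl.
  rewrite in_itv /= => /andP[q1 q2]; exists (ratr (- q)).
  split; first by exists (- q).
  rewrite rmorphN normrMn ger0_norm ?subr_ge0 1?(ltW q2)//.
  rewrite -[leLHS]mulr_natr -ler_pdivlMr//.
  by rewrite -invfM -expr2 lerBlDr -lerBlDl ltW.
have [r rP] := choice approx.
pose c n := (f (u n) + r n) *+ n.+1.
have cc : c @ \oo --> 0.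
  apply/cvgr0Pnorm_le => e e0.
  apply: filterS (near_infty_natSinv_lt (PosNum e0)) => n /ltW.
  exact: le_trans (rP n).2.
have [h hx hu] := interpolate_along_sequence cX hX ux cu cc.
pose S := T f - T 1 * f; pose G := T h - T 1 * h.
have GS n : `|S (u n)| <= `|G (u n)|.
  have [m um hm] := hu n.
  suff -> : G (u n) = S (u n) *+ m.+1.
    by rewrite normrMn mulrS lerDl mulrn_wge0.
  have -> : G (u n) = T h (u n) - T 1 (u n) * h (u n) by [].
  have -> : S (u n) = T f (u n) - T 1 (u n) * f (u n) by [].
  have -> : T h (u n) = (T f (u n) + T 1 (u n) * r m) *+ m.+1.
    rewrite (@zero_preserving_local _ T h ((f + cts_cst (r m)) *+ m.+1))//.
      rewrite additive_mulrn// cts_mulrnE addT cts_addE.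
      by rewrite zero_preserving_rational//; exact: (rP m).1.
    by rewrite hm /c um cts_mulrnE cts_addE.
  rewrite hm /c um mulrnAr -mulrnBl; congr (_ *+ _).
  by rewrite mulrDr opprD addrACA subrr addr0.
have Gx : G x = 0.
  by rewrite [G x](_ : _ = T h x - T 1 x * h x)// hx mulr0 zT// subrr.
have cts_u (g : continuousType X R) : `|g (u n)| @[n --> \oo] --> `|g x|.
  by apply: cvg_norm; apply: (cvg_comp _ _ cu); exact: (@cts_fun _ _ g).
have : `|S x| <= `|G x|.
  by apply: ler_cvg_to (cts_u S) (cts_u G) _; exact: nearW.
by rewrite Gx normr0 normr_le0 subr_eq0 => /eqP.
Qed.

(** * Isolated points *)

Lemma bump_continuous {X : topologicalType} (x : X) (a : R) :
  hausdorff_space X -> isolated [set: X] x ->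
  continuous (fun y => if `[< y = x >] then a else 0).
Proof.
move=> hX [_ [V xV]]; rewrite setIT => Vx y.
have [->|yx] := pselect (y = x).
  by apply: cvg_near_cst; apply: filterS xV => z; rewrite Vx => ->.
apply: cvg_near_cst.
have ox : open (~` [set x]).
  by rewrite openC; exact/accessible_closed_set1/hausdorff_accessible.
by apply: filterS (open_nbhs_nbhs (conj ox yx)) => z zx; rewrite !asboolF.
Qed.

(** At an isolated point x, evaluating at x, applying a nonlinear additive phi
and extending by 0 is additive and zero-preserving. As a multiplication it
would satisfy phi c = a x * c with a x = phi 1 = 1, but phi pi is rational. *)
Lemma upsilon_space_no_isolated {X : topologicalType} :
  upsilon_space R X -> isolated [set: X] = set0.
Proof.
move=> [_ hX upX]; apply/seteqP; split => // x isox.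
have [phi [addphi phi1 ratphi]] := rational_valued_additive_function R.
pose T (f : continuousType X R) : continuousType X R :=
  mkcts (bump_continuous _ (phi (f x)) hX isox).
have TE (f : continuousType X R) y :
    T f y = if `[< y = x >] then phi (f x) else 0 by [].
have Tx f : T f x = phi (f x) by rewrite TE asboolT.
have phi0 : phi 0 = 0 by apply: (addrI (phi 0)); rewrite -addphi !addr0.
have [||a Ta] := upX T.
- move=> g h; apply/continuousEP => y; rewrite cts_addE !TE.
  by case: ifP => _; rewrite ?addr0// cts_addE addphi.
- by move=> g y fy; rewrite TE; case: asboolP => // yx; rewrite -yx fy phi0.
have phiE c : phi c = c.
  have ax : a x = 1 by have := Tx 1; rewrite Ta mulr1 phi1.
  by have := Tx (cts_cst c); rewrite Ta cts_mulE ax mul1r => <-.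
by apply: (@pi_irrationnal R); rewrite -(phiE pi).
Qed.

End additive.

(** * Closures of unions *)

Section subspaces.
Variable R : realType.

Lemma upsilon_space_closure {X : topologicalType} {I : Type} (K : I -> set X) :
  compact [set: X] -> hausdorff_space X ->
  (forall i, upsilon_space R (set_type (K i))) ->
  upsilon_space R (set_type (closure (\bigcup_i K i))).
Proof.
move=> cX hX upK; set Z := closure _.
have KZ i (k : K i) : set_val k \in Z.
  rewrite inE; apply: subset_closure; exists i => //.
  exact: set_mem (valP k).
pose j i (k : K i) : Z := SigSub (KZ i k).
pose Kspace i : topologicalType := set_type (K i).
apply: (upsilon_space_dense_images R Kspace j) => //.
- apply: set_type_compact; apply: subclosed_compact (@closed_closure _ _) cX _.
  exact: subsetT.
- exact: set_type_hausdorff.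
- move=> i; apply: (continuous_to_set_type Z (j i)); exact: set_val_continuous.
- by move=> i k l /(congr1 set_val) kl; apply: (@set_val_inj _ (K i)).
move=> O [z Oz] [W oW WO]; rewrite -WO in Oz *.
have [y [[i _ Kiy] Wy]] : ((\bigcup_i K i) `&` W) !=set0.
  exact: set_mem (valP z) W (open_nbhs_nbhs (conj oW Oz)).
exists (j i (SigSub (mem_set Kiy))); split => //.
by exists i => //; exists (SigSub (mem_set Kiy)).
Qed.

End subspaces.

Theorem theorem12 (R : realType) (X : topologicalType)
    (compactX : compact [set: X]) (hausdorffX : hausdorff_space X) :
  [/\ (dense (sequential_limit_points X) -> upsilon_space R X),
      (first_countable X ->
        (upsilon_space R X <-> isolated [set: X] = set0)),
      (forall (I : Type) (K : I -> set X),
        (forall i, closed (K i)) ->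
        (forall i, upsilon_space R (set_type (K i))) ->
        upsilon_space R (set_type (closure (\bigcup_i K i)))),
      (exists! M : set X, maximal_compact_upsilon_subspace R M)
    & (forall Y : topologicalType,
        upsilon_space R Y -> upsilon_space R (X * Y)%type)].
Proof.
have dense_limit_points :
    dense (sequential_limit_points X) -> upsilon_space R X.
  move=> dX; split => // T addT zT.
  apply: dense_linear_at_multiplication dX _ => // x xlim.
  exact: linear_at_sequential_limit_point.
split=> //.
- move=> fcX; split; first exact: upsilon_space_no_isolated.
  move=> noiso; apply: dense_limit_points => O [x Ox] _; exists x; split => //.
  by apply: first_countable_sequential_limit_point => //; rewrite noiso.
- by move=> I K _; exact: upsilon_space_closure.
- pose I := {K : set X | compact_upsilon_subspace R K}.
  pose M := closure (\bigcup_(i : I) sval i).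
  have upM : compact_upsilon_subspace R M.
    split; last by apply: upsilon_space_closure => // -[K []].
    exact: subclosed_compact (@closed_closure _ _) compactX (@subsetT _ _).
  have subM K : compact_upsilon_subspace R K -> K `<=` M.
    move=> upK x Kx; apply: subset_closure.
    by exists (exist _ K upK).
  exists M; split.
    by split => // K upK MK; apply/seteqP; split => //; exact: subM.
  by move=> N [upN maxN]; rewrite (maxN M)//; exact: subM.
- move=> Y upY; have [cY hY _] := upY.
  pose slice (x : X) (y : Y) := (x, y).
  apply: (upsilon_space_dense_images R (fun=> Y) slice) => //.
  + by rewrite -setXTT; exact: compact_setX.
  + exact: hausdorff_setX.
  + by move=> x y; apply: cvg_pair; [exact: cvg_cst|exact: cvg_id].
  + by move=> x y z [].
  move=> O [[x y] Oxy] _; exists (x, y).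
  by split => //; exists x => //; exists y.
Qed.
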